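(* Consider the pursuit-evasion game on a sphere of radius $R$ with agent velocities $\vec v_E=v_E(\cos u_E\,\vec t_E+\sin u_E\,\vec n_{GC})$ and $\vec v_P=v_P(\cos u_P\,\vec t_P+\sin u_P\,\vec n_{GC})$ and time-to-capture cost $J=\int_0^\tau 1\,\mathrm{d}t=\tau$, under the following conditions: (a) the relative angular position between $P$ and $E$ is $\alpha\in(0,\pi)$ and obeys $\dot\alpha=\frac{v_E}{R}\cos u_E-\frac{v_P}{R}\cos u_P$; (b) $P$ has constant speed $v_P>0$, its control variable is the heading $u_P\in[0,2\pi)$, and its goal is to minimize the time to capture; (c) the control variables of $E$ are the speed $v_E\in[0,\mu v_P]$, where $0<\mu<1$, and the heading $u_E\in[0,2\pi)$, and its goal is to maximize the time to capture. Then the saddle point equilibrium strategies for all $\alpha\in(0,\pi)$ are defined by $$u_P=0\quad\text{and}\quad (v_E,u_E)=(\mu v_P,0).$$ Moreover, if the players are at relative angular position $\alpha\in(0,\pi)$ and both follow their equilibrium strategies, the time to capture is $$V(\alpha)=\frac{R\,\alpha}{(1-\mu)v_P}.$$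
   Context: A pursuer $P$ and an evader $E$ move on the sphere of radius $R$ centered at the origin of $\mathbb{R}^3$; their position vectors are $\vec P,\vec E$ with $|\vec P|=|\vec E|=R$. Both have simple motion: each player's velocity is tangent to the sphere and its direction is chosen freely and instantaneously. The angular distance is $\alpha\in[0,\pi]$, the angle between $\vec P$ and $\vec E$. For $\alpha\in(0,\pi)$ the unit vector $\vec n_{GC}$ is defined by $\vec n_{GC}\sin\alpha=\frac{1}{R^2}\vec P\times\vec E$; it is normal to the plane of the great circle through $P$ and $E$. The vectors $\vec t_P=\frac1R\vec n_{GC}\times\vec P$ and $\vec t_E=\frac1R\vec n_{GC}\times\vec E$ are the unit tangents to this great circle at $P$ and at $E$, oriented so that $\vec t_P$ points from $P$ toward $E$ along the shorter arc and $\vec t_E$ points away from $P$ (continuing in the same rotational sense). The headings $u_P,u_E$ are the angles of the velocities measured from these tangents. The capture time is $\tau=\inf\{t \mid \vec E=\vec P\}$, i.e. the first time at which $\alpha=0$. Strategies $\{\vec v_P^*,\vec v_E^*\}$ are (saddle point) equilibrium strategies if $\tau(\vec v_P^*,\vec v_E)\le\tau^*(\vec v_P^*,\vec v_E^* )\le\tau(\vec v_P,\vec v_E^* )$ for all admissible $\vec v_P,\vec v_E$. The resulting capture time $\tau^*$, as a function of the initial $\alpha$, is called the Value $V$ of the game. *)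

(* Defs.v *)
From mathcomp Require Import all_boot all_order all_algebra.
From mathcomp Require Import all_classical all_reals all_analysis.
From mathcomp Require Import ring lra.

Set Implicit Arguments.
Unset Strict Implicit.
Unset Printing Implicit Defensive.

Import Order.TTheory GRing.Theory Num.Theory.
Import numFieldNormedType.Exports.

Local Open Scope classical_set_scope.
Local Open Scope ring_scope.

Section Geometry.
Context {R : realType}.
Implicit Types (u v P E : 'rV[R]_3) (r : R).

Definition dot u v : R := (u *m v^T) 0 0.

(* The library norm on ['rV[R]_3] is the sup norm, hence this one. *)
Definition enorm u : R := Num.sqrt (dot u u).

Definition cross u v : 'rV[R]_3 :=
  let a := inord 0 : 'I_3 in let b := inord 1 in let c := inord 2 in
  \row_i [:: u 0 b * v 0 c - u 0 c * v 0 b;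
             u 0 c * v 0 a - u 0 a * v 0 c;
             u 0 a * v 0 b - u 0 b * v 0 a]`_i.

Definition on_sphere r u : Prop := enorm u = r.

Definition angle u v : R := acos (dot u v / (enorm u * enorm v)).

(* Unit normal of the great circle through P and E; meaningful only for
   0 < angle P E < pi, as are the two tangents. *)
Definition n_GC r P E : 'rV[R]_3 :=
  (sin (angle P E))^-1 *: ((r ^+ 2)^-1 *: cross P E).

Definition t_P r P E : 'rV[R]_3 := r^-1 *: cross (n_GC r P E) P.

Definition t_E r P E : 'rV[R]_3 := r^-1 *: cross (n_GC r P E) E.

Definition vel_P r (v u : R) P E : 'rV[R]_3 :=
  v *: (cos u *: t_P r P E + sin u *: n_GC r P E).

Definition vel_E r (v u : R) P E : 'rV[R]_3 :=
  v *: (cos u *: t_E r P E + sin u *: n_GC r P E).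

Lemma dotE u v : dot u v =
  u 0 (inord 0) * v 0 (inord 0) + u 0 (inord 1) * v 0 (inord 1) +
  u 0 (inord 2) * v 0 (inord 2).
Proof.
rewrite /dot mxE !big_ord_recl big_ord0 addr0 !mxE addrA.
have <- : ord0 = inord 0 :> 'I_3 by apply/val_inj; rewrite /= inordK.
have <- : lift ord0 ord0 = inord 1 :> 'I_3.
  by apply/val_inj; rewrite /= inordK.
by have <- : lift ord0 (lift ord0 ord0) = inord 2 :> 'I_3
  by apply/val_inj; rewrite /= inordK.
Qed.

Lemma crossE u v :
  ((cross u v 0 (inord 0) =
      u 0 (inord 1) * v 0 (inord 2) - u 0 (inord 2) * v 0 (inord 1)) *
   (cross u v 0 (inord 1) =
      u 0 (inord 2) * v 0 (inord 0) - u 0 (inord 0) * v 0 (inord 2)) *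
   (cross u v 0 (inord 2) =
      u 0 (inord 0) * v 0 (inord 1) - u 0 (inord 1) * v 0 (inord 0)))%type.
Proof. by rewrite !mxE !inordK. Qed.

Lemma on_sphereP r u : 0 < r -> on_sphere r u -> dot u u = r ^+ 2.
Proof.
move=> r0 <-; rewrite sqr_sqrtr// dotE.
by rewrite -!expr2 !addr_ge0// sqr_ge0.
Qed.

Lemma sin_angle_sqr r P E : 0 < r -> on_sphere r P -> on_sphere r E ->
  sin (angle P E) ^+ 2 = 1 - (dot P E / r ^+ 2) ^+ 2 /\
  cos (angle P E) = dot P E / r ^+ 2.
Proof.
move=> r0 rP rE; have := on_sphereP r0 rE; have := on_sphereP r0 rP.
rewrite /angle rP rE -expr2 => PP EE.
have r2 : 0 < r ^+ 2 by rewrite exprn_gt0.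
have lag : dot P E ^+ 2 + dot (cross P E) (cross P E) = dot P P * dot E E.
  by rewrite !dotE !crossE; ring.
have cge0 : 0 <= dot (cross P E) (cross P E).
  by rewrite dotE -!expr2 !addr_ge0// sqr_ge0.
have bnd : (dot P E / r ^+ 2) ^+ 2 <= 1.
  rewrite expr_div_n ler_pdivrMr ?exprn_gt0// mul1r.
  by move: lag; rewrite PP EE -expr2 => <-; rewrite lerDl.
have cosK : cos (acos (dot P E / r ^+ 2)) = dot P E / r ^+ 2.
  by rewrite acosK// in_itv/= -ler_norml -(@expr_le1 _ 2)// real_normK// num_real.
by rewrite sin2cos2 cosK.
Qed.

Lemma is_derive_coord (f : R -> 'rV[R]_3) t w i :
  is_derive t (1 : R) f w -> is_derive t (1 : R) (fun s => f s 0 i) (w 0 i).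
Proof.
move=> [df <-]; split; first exact: (derivable_mxP _ _ _).1.
by rewrite derive_mx// mxE.
Qed.

Lemma dot_cross r P E : 0 < r -> on_sphere r P -> on_sphere r E ->
  dot (cross P E) (cross P E) = r ^+ 4 * sin (angle P E) ^+ 2.
Proof.
move=> r0 sP sE; have [-> _] := sin_angle_sqr r0 sP sE.
have r_neq0 : r != 0 by rewrite gt_eqF.
have -> : dot (cross P E) (cross P E) = dot P P * dot E E - dot P E ^+ 2.
  by rewrite !dotE !crossE; ring.
by rewrite (on_sphereP r0 sP) (on_sphereP r0 sE); field.
Qed.

Lemma dot_vel_P r (v u : R) P E : 0 < r -> on_sphere r P -> on_sphere r E ->
  0 < angle P E < pi ->
  dot E (vel_P r v u P E) = v * cos u * r * sin (angle P E).
Proof.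
move=> r0 sP sE /sin_gt0_pi S0; have := dot_cross r0 sP sE.
rewrite /vel_P /t_P /n_GC; move: S0; set S := sin _ => S0 lag.
have [r_neq0 S_neq0] : r != 0 /\ S != 0 by rewrite !gt_eqF.
have -> : v * cos u * r * S = v * cos u * (dot (cross P E) (cross P E) / (r ^+ 3 * S)).
  by rewrite lag; field; rewrite r_neq0 S_neq0.
have zE (a : R) (w : 'rV[R]_3) i : (a *: w) 0 i = a * w 0 i by rewrite mxE.
have aE (w w' : 'rV[R]_3) i : (w + w') 0 i = w 0 i + w' 0 i by rewrite mxE.
rewrite !dotE !(zE, aE, crossE); field; by rewrite r_neq0 S_neq0.
Qed.

Lemma dot_vel_E r (v u : R) P E : 0 < r -> on_sphere r P -> on_sphere r E ->
  0 < angle P E < pi ->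
  dot P (vel_E r v u P E) = - (v * cos u * r * sin (angle P E)).
Proof.
move=> r0 sP sE /sin_gt0_pi S0; have := dot_cross r0 sP sE.
rewrite /vel_E /t_E /n_GC; move: S0; set S := sin _ => S0 lag.
have [r_neq0 S_neq0] : r != 0 /\ S != 0 by rewrite !gt_eqF.
have -> : v * cos u * r * S =
    v * cos u * (dot (cross P E) (cross P E) / (r ^+ 3 * S)).
  by rewrite lag; field; rewrite r_neq0 S_neq0.
have zE (a : R) (w : 'rV[R]_3) i : (a *: w) 0 i = a * w 0 i by rewrite mxE.
have aE (w w' : 'rV[R]_3) i : (w + w') 0 i = w 0 i + w' 0 i by rewrite mxE.
rewrite !dotE !(zE, aE, crossE); field; by rewrite r_neq0 S_neq0.
Qed.

(* The velocities above induce the law of motion of the angular distance; hence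
   [play] below does not assume it separately. *)
Lemma is_derive_angle r (v1 u1 v2 u2 t : R) (P E : R -> 'rV[R]_3) : 0 < r ->
  (\forall s \near t, on_sphere r (P s) /\ on_sphere r (E s)) ->
  0 < angle (P t) (E t) < pi ->
  is_derive t (1 : R) P (vel_P r v1 u1 (P t) (E t)) ->
  is_derive t (1 : R) E (vel_E r v2 u2 (P t) (E t)) ->
  is_derive t (1 : R) (fun s => angle (P s) (E s))
    (v2 / r * cos u2 - v1 / r * cos u1).
Proof.
move=> r0 sph /andP[a0 api] dP dE.
have [sP sE] := nbhs_singleton sph.
have [S2 C] := sin_angle_sqr r0 sP sE.
have PP := on_sphereP r0 sP; have EE := on_sphereP r0 sE.
have S0 : 0 < sin (angle (P t) (E t)) by rewrite sin_gt0_pi// a0 api.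
have r_neq0 : r != 0 by rewrite gt_eqF.
have S_neq0 : sin (angle (P t) (E t)) != 0 by rewrite gt_eqF.
pose g s := dot (P s) (E s) / r ^+ 2.
have gE : \near t, (acos \o g) t = angle (P t) (E t).
  near=> s; rewrite /g /angle/=.
  have [-> ->] : on_sphere r (P s) /\ on_sphere r (E s) by near: s.
  by rewrite -expr2.
pose d := r^-1 * sin (angle (P t) (E t)) * (v1 * cos u1 - v2 * cos u2).
have dg : is_derive t (1 : R) g d.
  have dPi i := is_derive_coord i dP; have dEi i := is_derive_coord i dE.
  have -> : g = (r ^+ 2)^-1 \*:
      ((fun s => P s 0 (inord 0)) * (fun s => E s 0 (inord 0)) +
       (fun s => P s 0 (inord 1)) * (fun s => E s 0 (inord 1)) +
       (fun s => P s 0 (inord 2)) * (fun s => E s 0 (inord 2))).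
    by apply/funext => s; rewrite /g dotE mulrC.
  have -> : d = (r ^+ 2)^-1 *
      (dot (E t) (vel_P r v1 u1 (P t) (E t)) +
       dot (P t) (vel_E r v2 u2 (P t) (E t))).
    by rewrite dot_vel_P ?dot_vel_E ?a0 // /d; field.
  apply: is_derive_eq; rewrite !dotE /GRing.scale/=; ring.
apply: (near_eq_is_derive gE).
have -> : v2 / r * cos u2 - v1 / r * cos u1 =
    - (Num.sqrt (1 - g t ^+ 2))^-1 * d.
  rewrite -S2 sqrtr_sqr gtr0_norm// /d; field.
  by rewrite r_neq0 S_neq0.
apply: is_derive1_comp; apply: is_derive1_acos.
rewrite -ltr_norml -(@expr_lt1 _ 2)// real_normK ?num_real//.
by rewrite -subr_gt0 -S2 exprn_gt0.
Unshelve. all: by end_near.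
Qed.

End Geometry.

Section Game.
Context {R : realType}.
Implicit Types r vP mu : R.

(* A strategy maps time and the two positions to a control: the heading u_P
   for P, the pair (v_E, u_E) for E.  Explicit dependence on time lets a player
   deviate to an arbitrary open-loop control; hence, against an opponent whose
   feedback strategy is fixed, any information pattern is covered, since what
   matters is the realized control as a function of time. *)
Definition strategy_P : Type := R -> 'rV[R]_3 -> 'rV[R]_3 -> R.
Definition strategy_E : Type := R -> 'rV[R]_3 -> 'rV[R]_3 -> R * R.

Definition admissible_P (sP : strategy_P) : Prop :=
  forall t p e, 0 <= sP t p e < 2 * pi.

Definition admissible_E vP mu (sE : strategy_E) : Prop :=
  forall t p e, 0 <= (sE t p e).1 <= mu * vP /\ 0 <= (sE t p e).2 < 2 * pi.

(* +oo when there is no capture. *)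
Definition capture_time (P E : R -> 'rV[R]_3) : \bar R :=
  ereal_inf [set t%:E | t in [set t : R | 0 <= t /\ P t = E t]].

(* Caratheodory solutions of the closed loop: headings may jump, so the motion
   equations are required almost everywhere before capture (what the curves do
   afterwards is irrelevant).  Speeds being bounded, absolute continuity of the
   solutions amounts to Lipschitz continuity.  The antipodal configuration,
   where the tangents are undefined, may be crossed but not occupied for a
   positive time; the latter is impossible anyway for players of different
   speeds, as it would force E' = - P'. *)
Record play r vP (sP : strategy_P) (sE : strategy_E)
    (P0 E0 : 'rV[R]_3) (P E : R -> 'rV[R]_3) : Prop := Play {
  play_P0 : P 0 = P0 ;
  play_E0 : E 0 = E0 ;
  play_sphere : forall t, 0 <= t -> on_sphere r (P t) /\ on_sphere r (E t) ;
  play_lipP : [lipschitz P t | t in [set t : R | 0 <= t]] ;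
  play_lipE : [lipschitz E t | t in [set t : R | 0 <= t]] ;
  play_motion : {ae lebesgue_measure, forall t : R,
    0 <= t -> (t%:E < capture_time P E)%E ->
    [/\ 0 < angle (P t) (E t) < pi,
        is_derive t 1 P (vel_P r vP (sP t (P t) (E t)) (P t) (E t)) &
        is_derive t 1 E (vel_E r (sE t (P t) (E t)).1 (sE t (P t) (E t)).2
                           (P t) (E t))]} }.

(* All times to capture that can result when P uses sP and E uses sE: the
   closed loop of two arbitrary feedbacks may have no solution or several. *)
Definition capture_times r vP (sP : strategy_P) (sE : strategy_E)
    (P0 E0 : 'rV[R]_3) : set (\bar R) :=
  [set tau | exists P E, play r vP sP sE P0 E0 P E /\ tau = capture_time P E].

(* P minimizes and E maximizes the time to capture. *)
Definition saddle_point r vP mu (sP : strategy_P) (sE : strategy_E) : Prop :=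
  [/\ admissible_P sP, admissible_E vP mu sE &
    forall P0 E0 : 'rV[R]_3,
      on_sphere r P0 -> on_sphere r E0 -> 0 < angle P0 E0 < pi ->
    exists tau : \bar R,
      [/\ capture_times r vP sP sE P0 E0 = [set tau],
          (forall sE', admissible_E vP mu sE' ->
             forall tau', capture_times r vP sP sE' P0 E0 tau' ->
             (tau' <= tau)%E) &
          (forall sP', admissible_P sP' ->
             forall tau', capture_times r vP sP' sE P0 E0 tau' ->
             (tau <= tau')%E)]].

End Game.

(* Main.v *)
(* Along a play the angular distance [a] has, at almost every time before
   capture, a derivative at most [- k] when P plays 0, and at least [- k] when E
   plays [(mu vP, 0)], where [k = (1 - mu) vP / r]. Integrating these bounds
   needs some care, because the controls are merely pointwise: [cos a] is
   visibly Lipschitz in time, but acos is not Lipschitz at 1 and -1. Truncating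
   [a] away from 0 and pi gives a Lipschitz function, and a Lipschitz function
   whose lower right Dini derivative is almost everywhere nonnegative is
   nondecreasing.
   For the lower bound the truncation is harmless, as it only reduces the
   decrease of [a]. For the upper bound, [cos a] is nondecreasing, so that [a]
   stays away from pi, and from 0 on any compact time interval without capture.
   A pair of uniform rotations along the great circle through the initial
   positions is a play, so the value is attained. *)
Require Import Defs.
From mathcomp Require Import all_boot all_order all_algebra.
From mathcomp Require Import all_classical all_reals all_analysis.
From mathcomp Require Import measurable_realfun ring lra.
Import Order.TTheory GRing.Theory Num.Theory.
Import numFieldNormedType.Exports.
Local Open Scope classical_set_scope.
Local Open Scope ring_scope.

Set Implicit Arguments.
Unset Strict Implicit.
Unset Printing Implicit Defensive.

(** * Monotonicity from one-sided derivative bounds almost everywhere *)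

(** The supremum of the points of [[a, b]] satisfying [S] satisfies [S] by the limit hypothesis; if
    it were below [b], the step hypothesis would give a larger such point. *)
Lemma real_induction {R : realType} (S : R -> Prop) (a b : R) : a <= b ->
  S a ->
  (forall c, a <= c <= b ->
    (forall e, 0 < e -> exists t, [/\ a <= t <= c, c - e < t & S t]) -> S c) ->
  (forall c, a <= c < b -> S c -> \forall t \near c^'+, S t) ->
  S b.
Proof.
move=> ab Sa Slim Sstep.
pose A := [set t | a <= t <= b /\ S t].
have supA : has_sup A.
  split; first by exists a; split; rewrite // lexx.
  by exists b => t [/andP[]].
have Aa : A a by split; rewrite // lexx.
have ac : a <= sup A by apply: ub_le_sup => //; case: supA.
have cb : sup A <= b by apply: ge_sup => [|t [/andP[]]//]; case: supA.
have Sc : S (sup A).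
  apply: Slim; first exact/andP.
  move=> e e0; have [t [/andP[at_ tb] St] et] := sup_adherent e0 supA.
  exists t; split => //; rewrite at_/=.
  by apply: ub_le_sup; [case: supA|split => //; apply/andP].
have [<-//|cltb] := eqVneq (sup A) b.
have {}cltb : sup A < b by rewrite lt_neqAle cltb.
have ne := Sstep _ (introT andP (conj ac cltb)) Sc.
near (sup A)^'+ => t.
have ct : sup A < t by near: t; exact: nbhs_right_gt.
have : t <= sup A.
  apply: ub_le_sup; first by case: supA.
  split; last by near: t.
  rewrite (le_trans ac (ltW ct))/=; near: t; exact: nbhs_right_le.
by rewrite leNgt ct.
Unshelve. all: by end_near. Qed.

(* A null exceptional set is covered by an open set [U] of measure at most
   [e]; then [f t + e (t - a) + L mu (U `&` `[a, t])] is nondecreasing, the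
   last term absorbing the possible decrease of [f] inside [U]. *)
Lemma ae_dini_ge0_le {R : realType} (f : R -> R) (a b L : R) :
  a <= b ->
  (forall s t, a <= s -> s <= t -> t <= b -> `|f t - f s| <= L * (t - s)) ->
  {ae lebesgue_measure, forall t, a <= t < b ->
    forall e, 0 < e -> \forall s \near t^'+, f t - f s <= e * (s - t)} ->
  f a <= f b.
Proof.
move=> ab flip [N [mN N0 bad]].
pose mu : {measure set (measurableTypeR R) -> \bar R} := @lebesgue_measure R.
have {}N0 : mu N = 0%E := N0.
have [aeqb|anb] := eqVneq a b; first by rewrite aeqb.
have altb : a < b by rewrite lt_neqAle anb.
have L0 : 0 <= L.
  have /(le_trans (normr_ge0 _)) := flip a b (lexx _) ab (lexx _).
  by rewrite pmulr_lge0 ?subr_gt0.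
apply/ler_addgt0Pr => e e0.
(* Since [phi b <= e1], the total error [e1 * (b - a) + L * phi b] is then at most [e]; the summand
   1 makes it fit with slack. *)
pose e1 := e / (b - a + L + 1).
have e10 : 0 < e1 by rewrite divr_gt0//; lra.
have [|U [oU NU UN]] := lebesgue_regularity_outer mN _ e10.
  by rewrite -/mu N0.
have mU : measurable U by exact: open_measurable.
have Ue : (mu U < e1%:E)%E.
  have -> : U = N `|` (U `\` N) by rewrite setDUK.
  have /le_lt_trans : (mu (N `|` (U `\` N)) <= mu N + mu (U `\` N))%E.
    by apply: measureU2 => //; exact: measurableD.
  by rewrite N0 add0e => /(_ _ UN).
have mu_le (A B : set R) : measurable A -> measurable B -> A `<=` B ->
    (mu A <= mu B)%E.
  by move=> mA mB AB; apply: (@le_measure _ _ _ mu); rewrite ?inE.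
pose phi t := fine (mu (U `&` `[a, t]) : \bar R).
have mUt t : measurable (U `&` `[a, t]) by exact: measurableI.
have phiU t : (mu (U `&` `[a, t]) <= e1%:E)%E.
  apply: le_trans (ltW Ue); apply: mu_le => //; exact: subIsetl.
have phiE t : ((phi t)%:E = mu (U `&` `[a, t]))%E.
  rewrite fineK// ge0_fin_numE//; exact: le_lt_trans (phiU t) (ltry _).
have phi_e t : phi t <= e1 by rewrite -lee_fin phiE.
have phi0 t : 0 <= phi t by exact: fine_ge0.
have phi_mono s t : s <= t -> phi s <= phi t.
  move=> st; rewrite -lee_fin !phiE; apply: mu_le => //.
  apply: setIS => x /=; rewrite !in_itv/= => /andP[-> xs].
  exact: le_trans st.
have phi_step s t : a <= s -> s <= t -> `[s, t] `<=` U ->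
    phi s + (t - s) <= phi t.
  move=> as_ st sub; rewrite -lee_fin EFinD !phiE.
  (* The half-open interval has the same length and is disjoint from [[a, s]], so the measures add
     up. *)
  have -> : ((t - s)%:E = mu [set` `]s, t]])%E.
    rewrite /mu/= lebesgue_measure_itv/= lte_fin.
    by case: ltgtP st => // -> _; rewrite subrr.
  rewrite -measureU//; first last.
    apply/seteqP; split => // x [[_]] /=; rewrite !in_itv/=.
    by move=> /andP[_ xs] /andP[/lt_le_trans/(_ xs)]; rewrite ltxx.
    exact: mUt.
  apply: mu_le => //; first exact: measurableU.
  move=> x [[Ux]|]/=; rewrite !in_itv/= => /andP[h1 h2]; split => //.
  - by rewrite h1 (le_trans h2).
  - by apply: sub; rewrite /= in_itv/= (ltW h1).
  - by rewrite (ltW (le_lt_trans as_ h1)).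
suff : f a <= f b + e1 * (b - a) + L * phi b.
  move=> /le_trans; apply; rewrite -addrA lerD2l.
  have : e1 * (b - a) + L * phi b <= e1 * (b - a + L + 1).
    have := ler_wpM2l L0 (phi_e b); lra.
  move=> /le_trans; apply; rewrite divfK//; lra.
pose S t := f a <= f t + e1 * (t - a) + L * phi t.
apply: (@real_induction _ S a b) => //.
- rewrite /S subrr mulr0 addr0 lerDl; exact: mulr_ge0.
- move=> c /andP[ac cb] close; apply/ler_addgt0Pr => d d0.
  (* Over this distance [f] changes by at most [d]; [L + 1] replaces [L], which may be 0. *)
  have dL : 0 < d / (L + 1) by rewrite divr_gt0//; lra.
  have [t [/andP[at_ tc] ct St]] := close _ dL.
  have := flip t c at_ tc cb; rewrite ler_norml => /andP[lo _].
  have h1 : L * (c - t) <= d.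
    have : (c - t) * (L + 1) <= d by rewrite -ler_pdivlMr; lra.
    lra.
  have h2 := ler_wpM2l L0 (phi_mono _ _ tc).
  have h3 : e1 * (t - a) <= e1 * (c - a) by rewrite ler_wpM2l ?(ltW e10)//; lra.
  by rewrite /S in St; lra.
- move=> c /andP[ac cb] Sc.
  (* Inside [U], [phi] grows at unit rate and [L * phi] pays for any Lipschitz decrease. Outside [U]
     the point is not in [N], so the Dini bound holds with slack [e1]. *)
  have [Uc|nUc] := pselect (U c).
  + have [d /= d0 dU] : nbhs_ball c U.
      by apply/nbhs_ballP; exact: open_nbhs_nbhs.
    near=> t.
    have ct : c < t by near: t; exact: nbhs_right_gt.
    have tb : t <= b by near: t; exact: nbhs_right_le.
    have td : t - c < d by near: t; exact: nbhs_right_ltDr.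
    have sub : `[c, t] `<=` U.
      move=> x/=; rewrite in_itv/= => /andP[cx xt]; apply: dU.
      by rewrite /ball/= ltr_distlC; apply/andP; split; lra.
    have := flip c t ac (ltW ct) tb; rewrite ler_norml => /andP[lo _].
    have := ler_wpM2l L0 (phi_step _ _ ac (ltW ct) sub).
    have : e1 * (c - a) <= e1 * (t - a) by rewrite ler_wpM2l ?(ltW e10)//; lra.
    rewrite /S in Sc *; lra.
  + have good : forall e, 0 < e ->
        \forall s \near c^'+, f c - f s <= e * (s - c).
      apply: contrapT => nc; apply: nUc; apply: NU; apply: bad => /=.
      by move=> /(_ (introT andP (conj ac cb))).
    have := good _ e10; apply: filterS2 (nbhs_right_ge c) => t ct h.
    have := ler_wpM2l L0 (phi_mono _ _ ct).
    rewrite /S in Sc *; lra.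
Unshelve. all: by end_near. Qed.

(** First-order expansion to the right of [t], in the form that the Dini hypothesis of
    [ae_dini_ge0_le] asks for. *)
Lemma is_derive_right_increment {R : realType} (f : R -> R) (t d e : R) :
  is_derive t (1 : R) f d -> 0 < e ->
  \forall s \near t^'+, `|f s - f t - d * (s - t)| <= e * (s - t).
Proof.
move=> [df dfE] e0.
have : h^-1 *: (f (h *: 1 + t) - f t) @[h --> 0^'] --> d by rewrite -dfE.
move=> /cvgrPdist_le/(_ _ e0) [δ /= δ0 H].
near=> s.
have ts : t < s by near: s; exact: nbhs_right_gt.
have sd : s - t < δ by near: s; exact: nbhs_right_ltDr.
have st0 : 0 < s - t by rewrite subr_gt0.
have := H (s - t); rewrite /ball/= sub0r normrN gtr0_norm//.
move=> /(_ sd (lt0r_neq0 st0)).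
rewrite /GRing.scale/= mulr1 subrK distrC => h.
have -> : f s - f t - d * (s - t) =
    ((s - t)^-1 * (f s - f t) - d) * (s - t).
  by rewrite mulrBl mulrAC mulVf ?mul1r// lt0r_neq0.
by rewrite normrM [X in _ * X]gtr0_norm// ler_wpM2r// ltW.
Unshelve. all: by end_near. Qed.

(** * Truncated angles and their cosines *)

(* Keeps an angle away from 0 and pi, where it is not a Lipschitz function of
   its cosine. *)
Definition truncate {R : realType} (eta x : R) :=
  Num.max eta (Num.min x (pi - eta)).

Lemma cos_nonincreasing {R : realType} (x y : R) :
  0 <= x -> x <= y -> y <= pi -> cos y <= cos x.
Proof.
move=> x0 xy ypi; have y0 := le_trans x0 xy; have xpi := le_trans xy ypi.
by rewrite leNgt ltr_cos ?in_itv/= ?x0 ?y0// -leNgt.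
Qed.

(** [sin x] is the cosine of the distance from [x] to [pi / 2], and that distance is largest at the
    ends of the interval. *)
Lemma sin_ge_of_interior {R : realType} (eta x : R) :
  0 < eta <= pi / 2 -> eta <= x <= pi - eta -> sin eta <= sin x.
Proof.
move=> /andP[e0 e1] /andP[ex xe].
have pi2 := pihalf_ge1 R.
rewrite -[sin eta]cosBpihalf -[sin x]cosBpihalf.
have [xp|xp] := leP x (pi / 2).
  rewrite -[cos (eta - _)]cosN -[cos (x - _)]cosN.
  apply: cos_nonincreasing; lra.
rewrite -[cos (eta - _)]cosN; apply: cos_nonincreasing; lra.
Qed.

Lemma cos_lipschitz {R : realType} (x y : R) : `|cos x - cos y| <= `|x - y|.
Proof.
wlog xy : x y / x <= y.
  by move=> H; case/orP: (le_total x y) => /H //; rewrite distrC (distrC y).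
have [|z _ E] := @MVT_segment R cos (fun z => - sin z) _ _ xy.
  by apply: derivable_within_continuous => z _; exact: ex_derive.
by rewrite distrC (distrC x) E normrM normrN ler_piMl// sin_max.
Qed.

(** If the truncations differ and [x <= y], both lie between [x] and [y], so their cosines differ by
    no more than those of [x] and [y]. The mean value theorem between them meets a sine of at least
    [sin eta]. *)
Lemma truncate_cos_le {R : realType} (eta x y : R) :
  0 < eta <= pi / 2 -> 0 <= x <= pi -> 0 <= y <= pi ->
  sin eta * `|truncate eta x - truncate eta y| <= `|cos x - cos y|.
Proof.
move=> eta_bnd; wlog xy : x y / x <= y.
  move=> H xb yb; case/orP: (le_total x y) => [/H|/H H']; first exact.
  by rewrite distrC (distrC (cos x)); exact: H'.
have /andP[e0 e1] := eta_bnd.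
move=> /andP[x0 xpi] /andP[y0 ypi].
have [->|neq] := eqVneq (truncate eta x) (truncate eta y).
  by rewrite subrr normr0 mulr0.
have xb : x <= pi - eta.
  apply: contraNT neq; rewrite -ltNge => h.
  by rewrite /truncate !min_r// ltW// (lt_le_trans h).
have yb : eta <= y.
  apply: contraNT neq; rewrite -ltNge => h.
  by rewrite /truncate !max_l// ge_min ?(ltW h)// (le_trans xy (ltW h)).
have Tge z : eta <= truncate eta z by rewrite le_max lexx.
have Ty : truncate eta y <= pi - eta.
  by rewrite ge_max ge_min lexx orbT andbT; lra.
have xTx : x <= truncate eta x by rewrite /truncate min_l// le_max lexx orbT.
have Tyy : truncate eta y <= y by rewrite ge_max yb ge_min lexx.
have TE : truncate eta x <= truncate eta y.
  have h : x <= Num.min y (pi - eta) by rewrite le_min xy.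
  by rewrite {1}/truncate (min_l xb) ge_max Tge le_max h orbT.
have cxy : cos y <= cos x by exact: cos_nonincreasing.
have TE' : truncate eta x < truncate eta y by rewrite lt_neqAle neq.
have [|z zI E] := @MVT R cos (fun z => - sin z) _ _ TE'.
  by apply: derivable_within_continuous => z _; exact: ex_derive.
have Tx := Tge x; have Ty' := Tge y.
have szI : sin eta <= sin z.
  by apply: sin_ge_of_interior => //; move: zI; rewrite in_itv/= => /andP[]; lra.
have c1 : cos (truncate eta x) <= cos x by apply: cos_nonincreasing; lra.
have c2 : cos y <= cos (truncate eta y) by apply: cos_nonincreasing; lra.
rewrite ler0_norm ?subr_le0// ger0_norm ?subr_ge0// opprB.
have : sin eta * (truncate eta y - truncate eta x) <=
    sin z * (truncate eta y - truncate eta x).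
  by rewrite ler_wpM2r// subr_ge0.
lra.
Qed.

Lemma truncate_id {R : realType} (eta x : R) :
  eta <= x <= pi - eta -> truncate eta x = x.
Proof. by rewrite /truncate => /andP[h1 h2]; rewrite min_l// max_r. Qed.

Lemma truncate0 {R : realType} (eta : R) :
  0 <= eta <= pi / 2 -> truncate eta 0 = eta.
Proof.
by move=> h; rewrite /truncate /Num.max /Num.min; do !case: ifP; lra.
Qed.

(* Truncation is nondecreasing and 1-Lipschitz, so it preserves upper bounds on
   a drop; hence the lower bound on the capture time can be read off the
   truncated angle. *)
Lemma truncate_drop {R : realType} (eta x y d : R) : 0 <= d -> x - y <= d ->
  truncate eta x - truncate eta y <= d.
Proof.
by move=> d0 h; rewrite /truncate /Num.max /Num.min; do !case: ifP; lra.
Qed.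

(** * Vectors of three-space and angles on the sphere *)

Lemma lagrange_identity {R : realType} (P E : 'rV[R]_3) :
  dot P E ^+ 2 + dot (cross P E) (cross P E) = dot P P * dot E E.
Proof. by rewrite !dotE !crossE; ring. Qed.

Lemma dot_ge0 {R : realType} (u : 'rV[R]_3) : 0 <= dot u u.
Proof. by rewrite dotE -!expr2 !addr_ge0// sqr_ge0. Qed.

Lemma norm_coord_le {R : realType} (u : 'rV[R]_3) i : `|u 0 i| <= `|u|.
Proof.
rewrite [X in _ <= X]/Num.norm/= mx_normrE.
exact: (le_bigmax _ (fun ij => `|u ij.1 ij.2|) (0, i)).
Qed.

Lemma norm_rV3_le {R : realType} (u : 'rV[R]_3) (M : R) : 0 <= M ->
  (forall i, `|u 0 i| <= M) -> `|u| <= M.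
Proof.
move=> M0 H; rewrite [X in X <= _]/Num.norm/= mx_normrE.
by apply/bigmax_leP; split => // -[i j] _/=; rewrite ord1.
Qed.

Lemma ord3_cases (i : 'I_3) : [\/ i = inord 0, i = inord 1 | i = inord 2].
Proof.
by case: i => -[|[|[|//]]] h; [apply: Or31|apply: Or32|apply: Or33];
  apply/val_inj; rewrite /= inordK.
Qed.

Lemma row3_eq {R : realType} (u v : 'rV[R]_3) :
  u 0 (inord 0) = v 0 (inord 0) -> u 0 (inord 1) = v 0 (inord 1) ->
  u 0 (inord 2) = v 0 (inord 2) -> u = v.
Proof.
by move=> h0 h1 h2; apply/rowP => i; case: (ord3_cases i) => ->.
Qed.

Lemma dot_eq0 {R : realType} (u : 'rV[R]_3) : dot u u = 0 -> u = 0.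
Proof.
rewrite dotE => /eqP; rewrite -!expr2 paddr_eq0 ?addr_ge0 ?sqr_ge0//.
rewrite paddr_eq0 ?sqr_ge0// !sqrf_eq0 => /andP[/andP[/eqP h0 /eqP h1] /eqP h2].
by apply: row3_eq; rewrite mxE.
Qed.

Section sphere.
Context {R : realType} (r : R) (r0 : 0 < r).
Implicit Types P E : 'rV[R]_3.

(** Cauchy-Schwarz, whose deficit is the squared length of the cross product. *)
Lemma norm_dot_le P E : on_sphere r P -> on_sphere r E -> `|dot P E| <= r ^+ 2.
Proof.
move=> sP sE; rewrite -ler_sqr ?nnegrE ?sqr_ge0// -normrX ger0_norm ?sqr_ge0//.
have := lagrange_identity P E; rewrite (on_sphereP r0 sP) (on_sphereP r0 sE).
by rewrite -expr2 => <-; rewrite lerDl dot_ge0.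
Qed.

Lemma angle_itv P E : on_sphere r P -> on_sphere r E -> 0 <= angle P E <= pi.
Proof.
move=> sP sE; suff h : -1 <= dot P E / (enorm P * enorm E) <= 1.
  by rewrite /angle acos_ge0 ?acos_lepi.
rewrite sP sE -expr2 -ler_norml normrM normfV (ger0_norm (sqr_ge0 r)).
by rewrite ler_pdivrMr ?exprn_gt0// mul1r norm_dot_le.
Qed.

(** Identifies capture with a zero angle: then [dot P E = r ^+ 2], which makes the squared length of
    [P - E] vanish. *)
Lemma angle_eq0 P E : on_sphere r P -> on_sphere r E ->
  (angle P E = 0) <-> (P = E).
Proof.
move=> sP sE; split => [a0|PE].
  have [_ ] := sin_angle_sqr r0 sP sE; rewrite a0 cos0 => d1.
  have {}d1 : dot P E = r ^+ 2.
    by apply/eqP; rewrite -[_ ^+ 2]mul1r d1 divfK// gt_eqF// exprn_gt0.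
  apply/eqP; rewrite -subr_eq0; apply/eqP/dot_eq0.
  have -> : dot (P - E) (P - E) = dot P P - dot P E *+ 2 + dot E E.
    by rewrite !dotE !mxE; ring.
  by rewrite (on_sphereP r0 sP) (on_sphereP r0 sE) d1; ring.
rewrite /angle -PE -acos1; congr acos.
by rewrite sP -expr2 (on_sphereP r0 sP) divff// gt_eqF// exprn_gt0.
Qed.

Lemma on_sphere_coord_le P i : on_sphere r P -> `|P 0 i| <= r.
Proof.
move=> sP; rewrite -ler_sqr ?nnegrE ?(ltW r0)// -normrX ger0_norm ?sqr_ge0//.
rewrite -(on_sphereP r0 sP) dotE -!expr2.
have s j := sqr_ge0 (P 0 j).
have := s (inord 0); have := s (inord 1); have := s (inord 2).
case: (ord3_cases i) => ->; lra.
Qed.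

(** Each of the three coordinate products splits bilinearly, with one factor bounded by [r] and the
    other by a sup norm; hence the factor [3 * r]. *)
Lemma dot_lipschitz P E P' E' : on_sphere r P' -> on_sphere r E ->
  `|dot P E - dot P' E'| <= 3 * r * (`|P - P'| + `|E - E'|).
Proof.
move=> sP sE; rewrite !dotE.
have term i : `|P 0 i * E 0 i - P' 0 i * E' 0 i| <=
    r * (`|P - P'| + `|E - E'|).
  have -> : P 0 i * E 0 i - P' 0 i * E' 0 i =
      E 0 i * (P - P') 0 i + P' 0 i * (E - E') 0 i by rewrite !mxE; ring.
  rewrite (le_trans (ler_normD _ _))// mulrDr !normrM lerD// ler_pM//.
  - exact: on_sphere_coord_le.
  - exact: norm_coord_le.
  - exact: on_sphere_coord_le.
  - exact: norm_coord_le.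
have := term (inord 0); have := term (inord 1); have := term (inord 2).
rewrite !ler_norml => /andP[a1 a2] /andP[b1 b2] /andP[c1 c2].
apply/andP; split; lra.
Qed.

Lemma cos_angle_lipschitz P E P' E' :
  on_sphere r P -> on_sphere r E -> on_sphere r P' -> on_sphere r E' ->
  `|cos (angle P E) - cos (angle P' E')| <=
    3 / r * (`|P - P'| + `|E - E'|).
Proof.
move=> sP sE sP' sE'.
rewrite (sin_angle_sqr r0 sP sE).2 (sin_angle_sqr r0 sP' sE').2 -mulrBl normrM.
rewrite normfV (ger0_norm (sqr_ge0 r)) ler_pdivrMr ?exprn_gt0//.
apply: le_trans (@dot_lipschitz P E P' E' sP' sE) _.
rewrite le_eqVlt; apply/orP; left; apply/eqP; field; exact: lt0r_neq0.
Qed.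

End sphere.

(** * Almost-everywhere statements and continuity on a set *)

Lemma ae_lebesgue_S2 {R : realType} (A B C : R -> Prop) :
  (forall x, A x -> B x -> C x) ->
  {ae lebesgue_measure, forall x : R, A x} ->
  {ae lebesgue_measure, forall x : R, B x} ->
  {ae lebesgue_measure, forall x : R, C x}.
Proof.
have F :=
  @ae_filter_ringOfSetsType _ (measurableTypeR R) R (@lebesgue_measure R).
exact: (@filterS2 _ _ F).
Qed.

Lemma ae_lebesgue_S {R : realType} (A B : R -> Prop) :
  (forall x, A x -> B x) ->
  {ae lebesgue_measure, forall x : R, A x} ->
  {ae lebesgue_measure, forall x : R, B x}.
Proof.
have F :=
  @ae_filter_ringOfSetsType _ (measurableTypeR R) R (@lebesgue_measure R).
exact: (@filterS _ _ F).
Qed.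

Lemma ae_lebesgue_neq {R : realType} (a : R) :
  {ae lebesgue_measure, forall t : R, t != a}.
Proof.
exists [set a]; split; first exact: measurable_set1.
  exact: lebesgue_measure_set1.
by move=> t /= /negP; rewrite negbK => /eqP.
Qed.

Lemma lipschitz_within_continuous {R : realType} (A : set R) (f : R -> R)
    (C : R) :
  0 < C -> (forall s t, A s -> A t -> `|f s - f t| <= C * `|s - t|) ->
  {within A, continuous f}.
Proof.
move=> C0 lipf; apply/subspace_continuousP => x Ax.
apply/cvgrPdist_le => e e0; rewrite near_withinE; near=> y => Ay.
apply: le_trans (lipf _ _ Ax Ay) _; rewrite mulrC -ler_pdivlMr//.
near: y; apply: (@cvgrPdist_le _ _ _ (nbhs x) _ id x).1 => //.
by rewrite divr_gt0.
Unshelve. all: by end_near. Qed.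

(** * Bounds on the capture time of an arbitrary play *)

Section play_theory.
Context {R : realType} (r vP : R) (sP : @strategy_P R) (sE : @strategy_E R).
Context (P0 E0 : 'rV[R]_3) (P E : R -> 'rV[R]_3).
Hypotheses (r0 : 0 < r) (pl : play r vP sP sE P0 E0 P E).

Let a t := angle (P t) (E t).
Let rate t := (sE t (P t) (E t)).1 / r * cos (sE t (P t) (E t)).2 -
  vP / r * cos (sP t (P t) (E t)).

Lemma play_angle_itv t : 0 <= t -> 0 <= a t <= pi.
Proof. by move=> /(play_sphere pl)[sPt sEt]; exact: (angle_itv r0). Qed.

Lemma ae_is_derive_angle : {ae lebesgue_measure, forall t : R, 0 <= t ->
  (t%:E < capture_time P E)%E ->
  0 < a t < pi /\ is_derive t (1 : R) a (rate t)}.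
Proof.
(* Time 0 is discarded because [is_derive_angle] wants both players on the sphere in a two-sided
   neighbourhood, while a play grants this for nonnegative times. *)
apply: ae_lebesgue_S2 (ae_lebesgue_neq 0) (play_motion pl) => t tn0 H t0 tc.
have [apt dP dE] := H t0 tc; split => //.
apply: (is_derive_angle r0) dP dE => //.
have tpos : 0 < t by rewrite lt_neqAle eq_sym tn0.
have := lt_nbhsr tpos; apply: filterS => s s0.
exact/(play_sphere pl)/ltW.
Qed.

Lemma play_cos_angle_lipschitz : exists C, 0 < C /\
  forall s t, 0 <= s -> 0 <= t -> `|cos (a s) - cos (a t)| <= C * `|s - t|.
Proof.
have [L1 L10 H1] := pinfty_ex_gt0 (play_lipP pl).
have [L2 L20 H2] := pinfty_ex_gt0 (play_lipE pl).
exists (3 / r * (L1 + L2)); split.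
  by rewrite mulr_gt0 ?divr_gt0// addr_gt0.
move=> s t s0 t0.
have [sPs sEs] := play_sphere pl s0; have [sPt sEt] := play_sphere pl t0.
apply: le_trans (cos_angle_lipschitz r0 sPs sEs sPt sEt) _.
rewrite -[X in _ <= X]mulrA ler_wpM2l ?divr_ge0// ?(ltW r0)// mulrDl lerD//.
  exact: (H1 (s, t) (conj s0 t0)).
exact: (H2 (s, t) (conj s0 t0)).
Qed.

Lemma play_truncate_lipschitz eta : 0 < eta <= pi / 2 -> exists C, 0 < C /\
  forall s t, 0 <= s -> 0 <= t ->
    `|truncate eta (a s) - truncate eta (a t)| <= C * `|s - t|.
Proof.
move=> eta_bnd; have /andP[e0 e1] := eta_bnd.
have pi2 := pihalf_ge1 R.
have seta : 0 < sin eta by apply: sin_gt0_pi; lra.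
have [C [C0 HC]] := play_cos_angle_lipschitz.
exists (C / sin eta); split; first by rewrite divr_gt0.
move=> s t s0 t0; rewrite mulrAC ler_pdivlMr// mulrC.
apply: le_trans (HC s t s0 t0).
apply: truncate_cos_le => //; exact: play_angle_itv.
Qed.

Lemma capture_time_ge0 : (0 <= capture_time P E)%E.
Proof. by apply/ereal_infP => _ [t [t0 _] <-]; rewrite lee_fin. Qed.

(** Were capture at [tau] with [k * tau < al], the truncated angle, falling at rate at most [k],
    would still be at least [al - k * tau] at [tau]. It is at most [eta] there, and [eta] is chosen
    smaller. *)
Lemma capture_time_ge k : 0 < k -> 0 < angle P0 E0 < pi ->
  (forall t, - k <= rate t) ->
  ((angle P0 E0 / k)%:E <= capture_time P E)%E.
Proof.
move=> k0 /andP[al0 alpi] rate_ge; rewrite leNgt; apply/negP => lt_cap.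
set al := angle P0 E0 in al0 alpi lt_cap.
have a0E : a 0 = al by rewrite /a (play_P0 pl) (play_E0 pl).
have cfin : capture_time P E \is a fin_num.
  by rewrite ge0_fin_numE ?capture_time_ge0// (lt_trans lt_cap)// ltry.
pose tau := fine (capture_time P E).
have tauE : (tau%:E = capture_time P E)%E by rewrite fineK.
have tau0 : 0 <= tau by rewrite -lee_fin tauE capture_time_ge0.
have tau_lt : 0 < al - k * tau.
  by move: lt_cap; rewrite -tauE lte_fin ltr_pdivlMr// mulrC subr_gt0.
(* Halving gives the strict inequality [eta < al - k * tau]; the other two terms make truncation fix
   the initial angle. *)
pose eta := Num.min (al - k * tau) (Num.min al (pi - al)) / 2.
have [eta0 eta1 eta2 eta3] :
    [/\ 0 < eta, eta < al - k * tau, eta <= al & al <= pi - eta].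
  have m0 : 0 < Num.min (al - k * tau) (Num.min al (pi - al)).
    by rewrite !lt_min tau_lt al0 subr_gt0.
  have : Num.min (al - k * tau) (Num.min al (pi - al)) <= al - k * tau.
    by rewrite ge_min lexx.
  have : Num.min (al - k * tau) (Num.min al (pi - al)) <= al.
    by rewrite !ge_min lexx orbT.
  have : Num.min (al - k * tau) (Num.min al (pi - al)) <= pi - al.
    by rewrite !ge_min lexx !orbT.
  by rewrite /eta; split; lra.
have eta_bnd : 0 < eta <= pi / 2 by apply/andP; split => //; lra.
have [C [C0 lipT]] := play_truncate_lipschitz eta_bnd.
(* The infimum [tau] is approached by meeting times [c], where the truncated angle equals [eta];
   Lipschitz continuity carries this back to [tau]. *)
have end_le : truncate eta (a tau) <= eta.
  apply/ler_addgt0Pr => d d0.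
  have : (capture_time P E < (tau + d / C)%:E)%E.
    by rewrite -tauE lte_fin ltrDl divr_gt0.
  move=> /ereal_inf_lt[_ [c [c0 PEc] <-]]; rewrite lte_fin => ctau.
  have tauc : tau <= c.
    by rewrite -lee_fin tauE; apply: ereal_inf_lbound; exists c.
  have [sPc sEc] := play_sphere pl c0.
  have ac0 : a c = 0 by exact/(angle_eq0 r0 sPc sEc).
  have := lipT _ _ tau0 c0.
  rewrite ac0 truncate0; last by apply/andP; split; lra.
  rewrite ler_norml => /andP[_]; rewrite distrC ger0_norm ?subr_ge0// => le1.
  have : C * (c - tau) <= d by rewrite mulrC -ler_pdivlMr//; lra.
  lra.
have : truncate eta (a 0) + k * 0 <= truncate eta (a tau) + k * tau.
  pose f t := truncate eta (a t) + k * t.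
  apply: (@ae_dini_ge0_le _ f 0 tau (C + k)) => //; rewrite /f.
    move=> s t s0 st tt.
    have := lipT t s (le_trans s0 st) s0.
    rewrite [X in _ * X]ger0_norm ?subr_ge0// !ler_norml => /andP[l1 l2].
    have kst : 0 <= k * (t - s) by rewrite mulr_ge0 ?(ltW k0)// subr_ge0.
    by apply/andP; split; lra.
  apply: ae_lebesgue_S ae_is_derive_angle => t H /andP[t0 ttau] e e0.
  have [|_ dat] := H t0; first by rewrite -tauE lte_fin.
  have := is_derive_right_increment dat e0.
  apply: filterS2 (nbhs_right_ge t) => s ts.
  rewrite ler_norml => /andP[lo _].
  have : - k * (s - t) <= rate t * (s - t) by rewrite ler_wpM2r ?subr_ge0.
  have := @truncate_drop _ eta (a t) (a s) ((k + e) * (s - t)).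
  have : 0 <= (k + e) * (s - t) by rewrite mulr_ge0 ?subr_ge0//; lra.
  move=> h0 /(_ h0) h1 h2.
  have : a t - a s <= (k + e) * (s - t) by lra.
  by move=> /h1; lra.
rewrite a0E truncate_id; last exact/andP.
lra.
Qed.

(** Without capture up to [T = al / k], the angle stays in a compact part of the open interval from
    0 to [pi], hence is Lipschitz on [[0, T]]. Falling at rate at least [k], it would reach 0 by
    time [T]. *)
Lemma capture_time_le k : 0 < k -> 0 < angle P0 E0 < pi ->
  (forall t, rate t <= - k) ->
  (capture_time P E <= (angle P0 E0 / k)%:E)%E.
Proof.
move=> k0 /andP[al0 alpi] rate_le; rewrite leNgt; apply/negP.
set al := angle P0 E0 in al0 alpi *.
have a0E : a 0 = al by rewrite /a (play_P0 pl) (play_E0 pl).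
set T := al / k => T_lt.
have T0 : 0 <= T by rewrite divr_ge0// ltW.
have free t : t <= T -> (t%:E < capture_time P E)%E.
  by move=> tT; apply: le_lt_trans T_lt; rewrite lee_fin.
have apos t : 0 <= t -> t <= T -> 0 < a t.
  move=> t0 tT; have /andP[a0 _] := play_angle_itv t0.
  rewrite lt_neqAle a0 andbT eq_sym; apply/eqP => at0.
  have := free t tT; rewrite ltNge => /negP; apply.
  apply: ereal_inf_lbound; exists t => //; split => //.
  by have [sPt sEt] := play_sphere pl t0; exact/(angle_eq0 r0 sPt sEt).
have [C [C0 lipC]] := play_cos_angle_lipschitz.
(* The cosine of the angle is Lipschitz with no truncation, and its derivative
   [- sin (a s) * rate s] is nonnegative. This keeps [a] below [al], away from [pi]. *)
have cos_ge t : 0 <= t -> t <= T -> cos (a 0) <= cos (a t).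
  move=> t0 tT; apply: (@ae_dini_ge0_le _ (fun t => cos (a t)) 0 t C) => //.
    move=> s s' s0 ss' _; have := lipC s' s (le_trans s0 ss') s0.
    by rewrite [X in _ <= _ * X]ger0_norm ?subr_ge0.
  apply: ae_lebesgue_S ae_is_derive_angle => s H /andP[s0 st] e e0.
  have [|/sin_gt0_pi sa das] := H s0; first by apply: free; lra.
  have dcos : is_derive s (1 : R) (cos \o a) (- sin (a s) * rate s).
    exact: is_derive1_comp.
  have := is_derive_right_increment dcos e0.
  apply: filterS2 (nbhs_right_ge s) => s' ss' /=.
  rewrite ler_norml => /andP[lo _].
  have : 0 <= (- sin (a s) * rate s) * (s' - s).
    rewrite mulr_ge0 ?subr_ge0// mulNr -mulrN mulr_ge0 ?(ltW sa)//.
    by have := rate_le s; lra.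
  lra.
have a_le t : 0 <= t -> t <= T -> a t <= al.
  move=> t0 tT; have := cos_ge t t0 tT; rewrite a0E.
  have /andP[at0 atpi] := play_angle_itv t0.
  by apply: contraTT; rewrite -!ltNge => h; rewrite ltr_cos// in_itv/=; lra.
(* A maximum of the cosine, known to be continuous, is a minimum of the angle, and that minimum is
   positive. *)
have [|c] := @EVT_max R (fun t => cos (a t)) 0 T T0.
  apply: lipschitz_within_continuous C0 _ => s t /=; rewrite !in_itv/=.
  by move=> /andP[s0 _] /andP[t0 _]; exact: lipC.
rewrite in_itv/= => /andP[c0 cT] cmax.
have ac_le t : 0 <= t -> t <= T -> a c <= a t.
  move=> t0 tT; have := cmax t; rewrite in_itv/= t0 tT => /(_ isT).
  have /andP[at0 atpi] := play_angle_itv t0.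
  have /andP[ac0 acpi] := play_angle_itv c0.
  by apply: contraTT; rewrite -!ltNge => h; rewrite ltr_cos// in_itv/=; lra.
have ac0 := apos c c0 cT.
have acal := a_le c c0 cT.
(* With this [eta] truncation is the identity along the play up to [T], so [a] inherits the
   Lipschitz bound. *)
pose eta := Num.min (a c) (pi - al).
have [eta0 eta1 eta2] : [/\ 0 < eta, eta <= a c & eta <= pi - al].
  by rewrite /eta lt_min ac0 subr_gt0 !ge_min !lexx orbT.
have eta_bnd : 0 < eta <= pi / 2 by apply/andP; split => //; lra.
have [C' [C'0 lipT]] := play_truncate_lipschitz eta_bnd.
have Ta t : 0 <= t -> t <= T -> truncate eta (a t) = a t.
  move=> t0 tT; apply: truncate_id; have := a_le t t0 tT; have := ac_le t t0 tT.
  by move=> *; apply/andP; split; lra.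
have : - a 0 - k * 0 <= - a T - k * T.
  apply: (@ae_dini_ge0_le _ (fun t => - a t - k * t) 0 T (C' + k)) => //.
    move=> s t s0 st tT.
    have := lipT t s (le_trans s0 st) s0.
    rewrite !Ta//; [|lra..].
    rewrite [X in _ * X]ger0_norm ?subr_ge0// !ler_norml => /andP[l1 l2].
    have kst : 0 <= k * (t - s) by rewrite mulr_ge0 ?(ltW k0)// subr_ge0.
    by apply/andP; split; lra.
  apply: ae_lebesgue_S ae_is_derive_angle => t H /andP[t0 tT] e e0.
  have [|_ dat] := H t0; first by apply: free; exact: ltW.
  have := is_derive_right_increment dat e0.
  apply: filterS2 (nbhs_right_ge t) => s ts.
  rewrite ler_norml => /andP[_ hi].
  have : rate t * (s - t) <= - k * (s - t) by rewrite ler_wpM2r ?subr_ge0.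
  lra.
have kT : k * T = al by rewrite /T mulrC divfK// lt0r_neq0.
have := apos T T0 (lexx _).
rewrite kT a0E; lra.
Qed.
End play_theory.

(** * Uniform rotations along a great circle as an equilibrium play *)

Lemma sin_lipschitz {R : realType} (x y : R) : `|sin x - sin y| <= `|x - y|.
Proof.
rewrite -!cosBpihalf (le_trans (cos_lipschitz _ _))//.
by rewrite opprB addrA subrK.
Qed.

Lemma is_derive_row {R : realType} n (f : R -> 'rV[R]_n) (t : R)
    (w : 'rV[R]_n) :
  (forall i, is_derive t (1 : R) (fun s => f s 0 i) (w 0 i)) ->
  is_derive t (1 : R) f w.
Proof.
move=> H.
have df : derivable f t 1.
  by apply/derivable_mxP => i j; rewrite ord1; case: (H j).
split=> //; rewrite derive_mx//; apply/rowP => j; rewrite mxE.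
by case: (H j).
Qed.

Section great_circle.
Context {R : realType} (r : R) (p q : 'rV[R]_3).
Hypotheses (r0 : 0 < r) (pp : dot p p = r ^+ 2) (qq : dot q q = r ^+ 2)
  (pq : dot p q = 0).

Definition great_circle (x : R) : 'rV[R]_3 := cos x *: p + sin x *: q.

Let gcE x i : great_circle x 0 i = cos x * p 0 i + sin x * q 0 i.
Proof. by rewrite !mxE. Qed.

Lemma dot_great_circle x y :
  dot (great_circle x) (great_circle y) = r ^+ 2 * cos (y - x).
Proof.
have -> : dot (great_circle x) (great_circle y) =
    cos x * cos y * dot p p + (cos x * sin y + sin x * cos y) * dot p q +
    sin x * sin y * dot q q by rewrite !dotE !gcE; ring.
by rewrite pp qq pq cosB; ring.
Qed.

Lemma on_sphere_great_circle x : on_sphere r (great_circle x).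
Proof.
rewrite /on_sphere /enorm dot_great_circle subrr cos0 mulr1 sqrtr_sqr.
by rewrite gtr0_norm.
Qed.

Lemma angle_great_circle x y : 0 <= y - x <= pi ->
  angle (great_circle x) (great_circle y) = y - x.
Proof.
move=> xy; rewrite /angle !on_sphere_great_circle dot_great_circle -expr2.
by rewrite mulrC mulKf ?cosK// ?in_itv// gt_eqF// exprn_gt0.
Qed.

(** The cross product of the two points is [sin (y - x)] times that of [p] and [q], and the sine
    cancels: the normal stays constant along the motion. *)
Lemma n_GC_great_circle x y : 0 < y - x < pi ->
  n_GC r (great_circle x) (great_circle y) = (r ^+ 2)^-1 *: cross p q.
Proof.
move=> xy; have /gt_eqF/negbT S0 := sin_gt0_pi xy.
rewrite /n_GC angle_great_circle; last by case/andP: xy => *; rewrite !ltW.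
have -> : cross (great_circle x) (great_circle y) = sin (y - x) *: cross p q.
  apply: row3_eq; rewrite [RHS]mxE !crossE !gcE sinB; ring.
by rewrite !scalerA mulrAC mulVf// mul1r.
Qed.

Lemma cross_cross_great_circle x :
  cross (cross p q) (great_circle x) =
    r ^+ 2 *: (cos x *: q - sin x *: p).
Proof.
(* The vanishing terms in [dot p q] are restored, which turns the claim into the triple product
   identity, polynomial in the coordinates. *)
have H i : (r ^+ 2 *: (cos x *: q - sin x *: p)) 0 i =
    cos x * (dot p p * q 0 i - dot p q * p 0 i) +
    sin x * (dot p q * q 0 i - dot q q * p 0 i).
  by rewrite !mxE pp qq pq; ring.
by apply: row3_eq; rewrite H !crossE !gcE !dotE; ring.
Qed.

(** Taking [z] to be [x] gives [t_P], and taking it to be [y] gives [t_E]. *)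
Lemma great_circle_tangent x y z : 0 < y - x < pi ->
  r^-1 *: cross (n_GC r (great_circle x) (great_circle y)) (great_circle z) =
    r^-1 *: (cos z *: q - sin z *: p).
Proof.
move=> xy; rewrite n_GC_great_circle//.
have -> : cross ((r ^+ 2)^-1 *: cross p q) (great_circle z) =
    (r ^+ 2)^-1 *: cross (cross p q) (great_circle z).
  have zE c (w : 'rV[R]_3) i : (c *: w) 0 i = c * w 0 i by rewrite mxE.
  by apply: row3_eq; rewrite !(zE, crossE); ring.
by rewrite cross_cross_great_circle scalerK// gt_eqF// exprn_gt0.
Qed.

Lemma is_derive_great_circle (c w t : R) :
  is_derive t (1 : R) (fun s => great_circle (c + w * s))
    (w *: (cos (c + w * t) *: q - sin (c + w * t) *: p)).
Proof.
apply: is_derive_row => i.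
pose l (s : R) := c + w * s.
have dl : is_derive t (1 : R) l w.
  have -> : l = cst c + w \*: (@id R) by [].
  by apply: is_derive_eq; rewrite add0r /GRing.scale/= mulr1.
have dcos := @is_derive1_comp R cos l t _ _ (is_derive_cos _) dl.
have dsin := @is_derive1_comp R sin l t _ _ (is_derive_sin _) dl.
have -> : (fun s => great_circle (c + w * s) 0 i) =
    p 0 i \*: (cos \o l) + q 0 i \*: (sin \o l).
  by apply/funext => s; rewrite gcE mulrC [X in _ + X]mulrC.
apply: is_derive_eq; rewrite !mxE /GRing.scale/=; ring.
Qed.

Lemma lipschitz_great_circle (c w : R) (A : set R) :
  [lipschitz great_circle (c + w * t) | t in A].
Proof.
(* A point of [A] makes the filter proper, as [klipschitzW] requires; the empty set is treated
   apart. *)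
have [->|/set0P[x Ax]] := eqVneq A set0; first exact: lipschitz_set0.
have pf : ProperFilter (globally (A `*` A)).
  exact: (@globally_properfilter _ _ (x, x)).
apply: (@klipschitzW _ _ _ (2 * r * `|w|)) => -[s t] _ /=.
have sp : on_sphere r p by rewrite /on_sphere /enorm pp sqrtr_sqr gtr0_norm.
have sq : on_sphere r q by rewrite /on_sphere /enorm qq sqrtr_sqr gtr0_norm.
have st : c + w * s - (c + w * t) = w * (s - t) by ring.
have dc := cos_lipschitz (c + w * s) (c + w * t).
have ds := sin_lipschitz (c + w * s) (c + w * t).
rewrite st in dc ds.
apply: norm_rV3_le; first by rewrite !mulr_ge0// ltW.
move=> i.
have mB (u v : 'rV[R]_3) : (u - v) 0 i = u 0 i - v 0 i by rewrite !mxE.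
rewrite mB !gcE.
set a := c + w * s; set b := c + w * t.
have -> : cos a * p 0 i + sin a * q 0 i - (cos b * p 0 i + sin b * q 0 i) =
    (cos a - cos b) * p 0 i + (sin a - sin b) * q 0 i by ring.
rewrite (le_trans (ler_normD _ _))//.
have -> : 2 * r * `|w| * `|s - t| = `|w * (s - t)| * r + `|w * (s - t)| * r.
  by rewrite normrM; ring.
by rewrite !normrM -!normrM lerD// normrM ler_pM// (on_sphere_coord_le r0).
Qed.

(** The gap is [al - k * t], so the rotations meet at [T = al / k]. Any time before capture is thus
    before [T], where the gap lies strictly between 0 and [pi] and the tangents are the derivatives
    of the rotations up to speed. *)
Lemma great_circle_play (vP mu al : R) :
  0 < al < pi -> 0 < vP -> 0 < mu < 1 ->
  play r vP (fun _ _ _ => 0) (fun _ _ _ => (mu * vP, 0)) p (great_circle al)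
    (fun t => great_circle (0 + vP / r * t))
    (fun t => great_circle (al + mu * vP / r * t)).
Proof.
move=> /andP[al0 alpi] v0 /andP[mu0 mu1].
set P := (X in play _ _ _ _ _ _ X _); set E := (X in play _ _ _ _ _ _ _ X).
pose k := (1 - mu) * vP / r; pose T := al / k.
have k0 : 0 < k by rewrite divr_gt0// mulr_gt0// subr_gt0.
have diff t : al + mu * vP / r * t - (0 + vP / r * t) = al - k * t.
  by rewrite /k; ring.
have kT t : 0 <= t -> t < T -> 0 < al - k * t < pi.
  move=> t0; rewrite ltr_pdivlMr// mulrC => tT.
  have : 0 <= k * t by rewrite mulr_ge0// ltW.
  by move=> kt; apply/andP; split; lra.
have capT : (capture_time P E <= T%:E)%E.
  apply: ereal_inf_lbound; exists T => //.
  split; first by rewrite divr_ge0 ?ltW.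
  congr great_circle; apply/eqP; rewrite eq_sym -subr_eq0 diff.
  by rewrite mulrC divfK ?subrr// gt_eqF.
split.
- by rewrite /P mulr0 addr0 /great_circle cos0 sin0 scale1r scale0r addr0.
- by rewrite /E mulr0 addr0.
- by move=> t _; split; exact: on_sphere_great_circle.
- exact: lipschitz_great_circle.
- exact: lipschitz_great_circle.
apply: ae_lebesgue_S (ae_lebesgue_neq 0) => t _ t0 /lt_le_trans/(_ capT).
rewrite lte_fin => /(kT _ t0) gap.
have gap' : 0 < al + mu * vP / r * t - (0 + vP / r * t) < pi by rewrite diff.
split.
- by rewrite angle_great_circle// !ltW//; case/andP: gap'.
- rewrite /vel_P /t_P great_circle_tangent// cos0 sin0 scale1r scale0r addr0.
  by rewrite scalerA; exact: is_derive_great_circle.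
- rewrite /vel_E /t_E great_circle_tangent//= cos0 sin0 scale1r scale0r addr0.
  by rewrite scalerA; exact: is_derive_great_circle.
Qed.

End great_circle.

(** Gram-Schmidt: [q] is the part of [E] orthogonal to [P], divided by the sine of the angle to have
    length [r]. *)
Lemma great_circle_through {R : realType} (r : R) (P E : 'rV[R]_3) :
  0 < r -> on_sphere r P -> on_sphere r E -> 0 < angle P E < pi ->
  exists q, [/\ dot q q = r ^+ 2, dot P q = 0 &
    E = great_circle P q (angle P E)].
Proof.
move=> r0 sP sE al; have /gt_eqF/negbT S0 := sin_gt0_pi al.
have [S2 C] := sin_angle_sqr r0 sP sE.
move: S2; rewrite -C; move: C S0; set c := cos _; set s := sin _ => C S0 S2.
have rn0 : r != 0 by rewrite gt_eqF.
have PE : dot P E = c * r ^+ 2 by rewrite C divfK// expf_neq0.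
have PP := on_sphereP r0 sP; have EE := on_sphereP r0 sE.
exists (s^-1 *: (E - c *: P)); split.
- have -> : dot (s^-1 *: (E - c *: P)) (s^-1 *: (E - c *: P)) =
      (s ^+ 2)^-1 * (dot E E - 2 * c * dot P E + c ^+ 2 * dot P P).
    by rewrite !dotE !mxE; field.
  rewrite PP EE PE; apply: (mulfI (expf_neq0 2 S0)).
  by rewrite mulVKf ?expf_neq0// S2; ring.
- have -> : dot P (s^-1 *: (E - c *: P)) = s^-1 * (dot P E - c * dot P P).
    by rewrite !dotE !mxE; ring.
  by rewrite PP PE subrr mulr0.
- by rewrite /great_circle -/c -/s scalerA mulfV// scale1r addrC subrK.
Qed.

(** * Saddle point inequalities and the value of the game *)

Theorem theorem1 (R : realType) (r vP mu : R)
    (r_gt0 : 0 < r) (vP_gt0 : 0 < vP) (mu01 : 0 < mu < 1) :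
  let sP : strategy_P := fun _ _ _ => 0 in
  let sE : strategy_E := fun _ _ _ => (mu * vP, 0) in
  saddle_point r vP mu sP sE /\
  forall (alpha : R) (P0 E0 : 'rV[R]_3),
    0 < alpha < pi -> on_sphere r P0 -> on_sphere r E0 ->
    angle P0 E0 = alpha ->
    capture_times r vP sP sE P0 E0 = [set (r * alpha / ((1 - mu) * vP))%:E].
Proof.
move=> sP sE; have /andP[mu0 mu1] := mu01.
(* The rate at which the angle closes when both players follow their equilibrium strategies. *)
pose k := (1 - mu) * vP / r.
have k0 : 0 < k by rewrite divr_gt0// mulr_gt0// subr_gt0.
have pi0 := pi_gt0 R.
have v0 : 0 < vP / r by rewrite divr_gt0.
have admP : admissible_P sP by move=> *; rewrite lexx mulr_gt0.
have admE : admissible_E vP mu sE.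
  by move=> * /=; rewrite !lexx mulr_ge0 ?ltW// mulr_gt0.
have upper sE' P0 E0 tau : admissible_E vP mu sE' -> 0 < angle P0 E0 < pi ->
    capture_times r vP sP sE' P0 E0 tau -> (tau <= (angle P0 E0 / k)%:E)%E.
  move=> adm al [P [E [pl ->]]]; apply: (capture_time_le r_gt0 pl) => // t.
  have [/andP[vE0 vEm] _] := adm t (P t) (E t).
  rewrite /sP cos0 mulr1; set v := (_.1) in vE0 vEm *; set u := (_.2).
  have : v / r * cos u <= v / r * 1.
    by rewrite ler_wpM2l ?cos_le1// divr_ge0// ltW.
  have : v / r <= mu * vP / r by rewrite ler_wpM2r// invr_ge0 ltW.
  by rewrite /k; lra.
have lower sP' P0 E0 tau : 0 < angle P0 E0 < pi ->
    capture_times r vP sP' sE P0 E0 tau -> ((angle P0 E0 / k)%:E <= tau)%E.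
  move=> al [P [E [pl ->]]]; apply: (capture_time_ge r_gt0 pl) => // t.
  rewrite /sE/= cos0 mulr1; set u := sP' _ _ _.
  have : vP / r * cos u <= vP / r * 1 by rewrite ler_wpM2l ?cos_le1// ltW.
  by rewrite /k; lra.
have value P0 E0 : on_sphere r P0 -> on_sphere r E0 -> 0 < angle P0 E0 < pi ->
    capture_times r vP sP sE P0 E0 = [set (angle P0 E0 / k)%:E].
  move=> sP0 sE0 al.
  (* The two one-sided bounds, applied to the equilibrium pair itself, leave a single possible
     capture time. *)
  have eqk tau : capture_times r vP sP sE P0 E0 tau ->
      tau = (angle P0 E0 / k)%:E.
    move=> h; apply/eqP; rewrite eq_le (upper _ _ _ _ admE al h).
    exact: lower h.
  apply/seteqP; split => [tau /eqk//|_ /= ->].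
  have [q [qq P0q E0E]] := great_circle_through r_gt0 sP0 sE0 al.
  have PP := on_sphereP r_gt0 sP0.
  have pl := great_circle_play r_gt0 PP qq P0q al vP_gt0 mu01.
  rewrite -E0E in pl.
  (* The rotations provide some capture time, and [eqk] identifies it, so it need not be computed
     from the curves. *)
  have [tau h] : capture_times r vP sP sE P0 E0 !=set0.
    by do 3 eexists; split; [exact: pl|].
  by rewrite -(eqk _ h).
split; last first.
  move=> al P0 E0 al_bnd sP0 sE0 alE; rewrite value ?alE//.
  congr [set (_)%:E]; rewrite /k; field.
  by rewrite !gt_eqF// subr_gt0.
split => // P0 E0 sP0 sE0 al; exists (angle P0 E0 / k)%:E; split.
- exact: value.
- by move=> sE' adm tau'; exact: upper.
- by move=> sP' _ tau'; exact: lower.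
Qed.
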